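(* If $u \in S_{m+1}$ and $v \in S_{n+1}$ then $\nabla_{\sqcup\!\sqcup}([u]\otimes [v]) = \sum_{\pi \in \mathcal{S}_{\sqcup\!\sqcup}(u,v)} [\pi]$.
   Context: Let $\Bbbk$ be a field. For a word (finite sequence of positive integers) $w=w_1\cdots w_k$ with $\max(w)\le n$, $[w,n]$ denotes the linear endomorphism of the $\Bbbk$-span of all words sending a word $v$ of length $n$ to $v_{w_1}\cdots v_{w_k}$ and other words to $0$. Define $\nabla_{\sqcup\!\sqcup}([v,m]\otimes[w,n]) = [v\sqcup\!\sqcup (w\uparrow m), m+n]$, extended bilinearly, where $\sqcup\!\sqcup$ is the shuffle product of words and $w\uparrow m$ adds $m$ to each letter. For $\pi\in S_{n+1}$ (generated by $s_i=(i,i+1)$) with reduced words $\mathcal{R}(\pi)$, set $[\pi]=\sum_{w\in\mathcal{R}(\pi)}[w,n]$. Permutations are written in one-line notation. For a word with distinct letters, $\operatorname{fl}$ replaces letters by their relative ranks. For words $a=a_1\cdots a_k$, $b=b_1\cdots b_l$ without repeated letters, with letter sets $A,B\subseteq\{1,\dots,k+l\}$, let $\phi:A\to\{1,\dots,k+l\}\setminus B$ and $\psi:B\to\{1,\dots,k+l\}\setminus A$ be the order-preserving bijections and set $a/\!/b=a\psi(b)$ and $a\backslash\!\backslash b=\phi(a)b$. For $u\in S_{m+1}$, $v\in S_{n+1}$, let $w_i=v_i+m$ and let $j,k$ be such that $u_j=w_{k+1}=m+1$. Define $\mathcal{S}_{\sqcup\!\sqcup}(u,v)\subseteq S_{m+n+1}$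 inductively: (a) if $u_{m+1}=m+1$, it is $\{u_1\cdots u_m w_1\cdots w_{n+1}\}$; (b) if $w_1=m+1$, it is $\{u_1\cdots u_{m+1}w_2\cdots w_{n+1}\}$; (c) otherwise, with $\tilde u=\operatorname{fl}(u_{j+1}\cdots u_{m+1})$ and $\tilde v=\operatorname{fl}(v_1\cdots v_k)$, it is $\{u_1\cdots u_j/\!/\sigma:\sigma\in\mathcal{S}_{\sqcup\!\sqcup}(\tilde u,v)\}\sqcup\{\sigma\backslash\!\backslash w_{k+1}\cdots w_{n+1}:\sigma\in\mathcal{S}_{\sqcup\!\sqcup}(u,\tilde v)\}$. *)

(* Defs.v *)
From mathcomp Require Import all_boot all_algebra.
Set Implicit Arguments. Unset Strict Implicit. Unset Printing Implicit Defensive.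
Import GRing.Theory.
Local Open Scope ring_scope.

(* Words are [seq nat] (letters are positive integers).
   Permutations of S_{N} are words in one-line notation (a permutation of 1..N). *)

(* ---------- Operators [w,n] on the span of words ----------
   A linear endomorphism f of the K-span of all words is determined by the
   images of the basis words; we encode f as  f x y = coefficient of the word
   y in f(x).  Two endomorphisms are equal iff these functions are equal. *)
Definition op (K : fieldType) := seq nat -> seq nat -> K.

Definition brk (K : fieldType) (wn : seq nat * nat) : op K :=
  fun x y => ((size x == wn.2)%N && ([seq nth 0%N x i.-1 | i <- wn.1] == y))%:R.

Definition opsum (K : fieldType) (L : seq (seq nat * nat)) : op K :=
  fun x y => \sum_(p <- L) brk K p x y.

Fixpoint shuffle (a : seq nat) : seq nat -> seq (seq nat) :=
  match a with
  | [::] => fun b => [:: b]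
  | x :: a' => fix sh (b : seq nat) : seq (seq nat) :=
      match b with
      | [::] => [:: x :: a']
      | y :: b' => [seq x :: s | s <- shuffle a' b] ++ [seq y :: s | s <- sh b']
      end
  end.

Definition wup (w : seq nat) (m : nat) : seq nat := [seq (i + m)%N | i <- w].

(* ---------- formal tensors and nabla ----------
   An element of End (x) End spanned by the [v,m] (x) [w,n]:
   a list of (coefficient, ((v,m),(w,n))) meaning sum c [v,m] (x) [w,n]. *)
Definition tens (K : fieldType) := seq (K * ((seq nat * nat) * (seq nat * nat))).

Definition nabla (K : fieldType) (t : tens K) : op K :=
  fun x y => \sum_(e <- t)
    e.1 * opsum K [seq (c, (e.2.1.2 + e.2.2.2)%N)
                  | c <- shuffle e.2.1.1 (wup e.2.2.1 e.2.1.2)] x y.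

(* right multiplication by s_i = (i,i+1): swap positions i and i+1 (1-based) *)
Definition sswap (i : nat) (p : seq nat) : seq nat :=
  [seq nth 0%N p (if k == i.-1 then i else if k == i then i.-1 else k)
  | k <- iota 0 (size p)].

Definition perm_of_word (N : nat) (w : seq nat) : seq nat :=
  foldl (fun p i => sswap i p) (iota 1 N) w.

Fixpoint words (n L : nat) : seq (seq nat) :=
  match L with
  | 0 => [:: [::]]
  | L'.+1 => [seq i :: w | i <- iota 1 n, w <- words n L']
  end.

(* Coxeter length = number of inversions *)
Definition ninv (p : seq nat) : nat :=
  sumn [seq count (fun y => y < nth 0%N p i)%N (drop i.+1 p) | i <- iota 0 (size p)].

Definition redwords (p : seq nat) : seq (seq nat) :=
  [seq w <- words (size p).-1 (ninv p) | perm_of_word (size p) w == p].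

Definition bracket (K : fieldType) (p : seq nat) : op K :=
  opsum K [seq (w, (size p).-1) | w <- redwords p].

Definition tens_bracket (K : fieldType) (u v : seq nat) : tens K :=
  [seq (1, ((a, (size u).-1), (b, (size v).-1))) | a <- redwords u, b <- redwords v].

Definition fl (s : seq nat) : seq nat :=
  [seq (count (fun y => y < x) s).+1 | x <- s]%N.

Definition slash (a b : seq nat) : seq nat :=
  let comp := [seq y <- iota 1 (size a + size b) | y \notin a] in
  a ++ [seq nth 0%N comp (count (fun y => y < x) b)%N | x <- b].

Definition bslash (a b : seq nat) : seq nat :=
  let comp := [seq y <- iota 1 (size a + size b) | y \notin b] in
  [seq nth 0%N comp (count (fun y => y < x) a)%N | x <- a] ++ b.

(* recursion with fuel (size u + size v suffices: it strictly decreases) *)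
Fixpoint Ssh_rec (fuel : nat) (u v : seq nat) : seq (seq nat) :=
  match fuel with
  | 0 => [::]
  | f.+1 =>
    let m := (size u).-1 in
    let w := wup v m in
    if nth 0%N u m == m.+1 then [:: take m u ++ w]
    else if nth 0%N w 0 == m.+1 then [:: u ++ behead w]
    else
      let j := (index m.+1 u).+1 in   (* u_j = m+1 *)
      let k := index m.+1 w in        (* w_{k+1} = m+1 *)
      [seq slash (take j u) s | s <- Ssh_rec f (fl (drop j u)) v]
      ++ [seq bslash s (drop k w) | s <- Ssh_rec f u (fl (take k v))]
  end.

Definition Ssh (u v : seq nat) : seq (seq nat) :=
  undup (Ssh_rec (size u + size v) u v).

(* Main.v *)
(** The words of R(u) shuffled with R(v) raised by m are grouped by their product.
Let [peel u v p] mean that [p] can be reduced to a single letter by repeatedly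
deleting either its first letter together with the first letter of [u], which must
have the same rank from below, or its last letter together with the last letter of
[v], which must have the same rank from above. The recursion defining S(u, v) is a
normal form for this process: a first letter of [u] that is not maximal can always
be deleted first, so the only real choices occur when the maximum of [u] competes
with the minimum of [v]. Hence S(u, v) is the set of permutations [p] with
[peel u v p].

The relation is compatible with right multiplication by s_i for i <= m on [u] and
[p], and by s_(i-m) on [v] and s_i on [p] for i > m. By induction on the last letter,
a word [w] restricts to reduced words of [u] and [v] on the letters <= m and > m
exactly when it is reduced and [peel u v] holds for its product. Both sides of the
theorem are thus sums over the same duplicate-free list of words. *)
Require Import Defs.
From mathcomp Require Import all_boot all_algebra.
From mathcomp Require Import zify.
From Stdlib Require Import FunctionalExtensionality.
Set Implicit Arguments. Unset Strict Implicit. Unset Printing Implicit Defensive.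

(** * The peeling relation *)


Definition strict_order (r : rel nat) : Prop :=
  [/\ irreflexive r, transitive r & forall x y, x != y -> r x y || r y x].

Lemma strict_order_ltn : strict_order ltn.
Proof.
split=> [x|y x z|x y] /=; [exact: ltnn | exact: ltn_trans | by rewrite neq_ltn].
Qed.

Lemma strict_order_flip (r : rel nat) :
  strict_order r -> strict_order (fun x y => r y x).
Proof.
case=> irr tr tot; split=> [x|y x z /= xy yz|x y] /=; first exact: irr.
  exact: tr yz xy.
by move/tot; rewrite orbC.
Qed.

(* [r] is abstract so that the mirror image of a statement is obtained by reversing
   the words and flipping [r] (lemma [peel_rev]). *)
Inductive peel (r : rel nat) : seq nat -> seq nat -> seq nat -> Prop :=
| peel1 a b c : peel r [:: a] [:: b] [:: c]
| peelL x y u v p : count (r^~ y) p = count (r^~ x) u ->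
    peel r u v p -> peel r (x :: u) v (y :: p)
| peelR y z u v p : count (r z) p = count (r y) v ->
    peel r u v p -> peel r u (rcons v y) (rcons p z).

Lemma peel_size (r : rel nat) (u v p : seq nat) :
  peel r u v p -> [/\ 0 < size u, 0 < size v & (size p).+1 = size u + size v].
Proof.
elim=> [//|x y u' v' p' _ _ [h1 h2 h3]|y z u' v' p' _ _ [h1 h2 h3]];
  by rewrite ?size_rcons /=; split=> //; lia.
Qed.

Lemma peel_inv (r : rel nat) (u v p : seq nat) : peel r u v p ->
  [\/ [/\ size u = 1, size v = 1 & size p = 1],
      exists x y u' p', [/\ u = x :: u', p = y :: p',
        count (r^~ y) p' = count (r^~ x) u' & peel r u' v p']
    | exists y z v' p', [/\ v = rcons v' y, p = rcons p' z,
        count (r z) p' = count (r y) v' & peel r u v' p']].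
Proof.
case=> [a b c|x y u' v' p' e h|y z u' v' p' e h]; first by constructor 1.
  by constructor 2; exists x, y, u', p'.
by constructor 3; exists y, z, v', p'.
Qed.

Lemma peel_rev (r : rel nat) (u v p : seq nat) :
  peel r u v p -> peel (fun x y => r y x) (rev v) (rev u) (rev p).
Proof.
elim=> [a b c|x y u' v' p' e _ h|y z u' v' p' e _ h]; first exact: peel1.
  by rewrite !rev_cons; apply: peelR h; rewrite !count_rev.
by rewrite !rev_rcons; apply: peelL h; rewrite !count_rev.
Qed.

(** Every rank condition of [peel] compares letters inside a single word, so the three words may be
    relabelled independently. A pair of maps for each word lets one statement serve in both
    directions, with [id] on one side. *)
Lemma peel_map (r : rel nat) (f f' g g' h h' : nat -> nat) (u v p : seq nat) :
  {in u &, forall x y, r (f x) (f y) = r (f' x) (f' y)} ->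
  {in v &, forall x y, r (g x) (g y) = r (g' x) (g' y)} ->
  {in p &, forall x y, r (h x) (h y) = r (h' x) (h' y)} ->
  peel r (map f u) (map g v) (map h p) -> peel r (map f' u) (map g' v) (map h' p).
Proof.
elim: {p}(size p) {-2}p (leqnn (size p)) u v => [|k IH] p le_p u v eu ev ep P.
  by have [_ _] := peel_size P; have [] := peel_size P; rewrite !size_map; lia.
have subL (s : seq nat) x : {subset s <= x :: s}.
  by move=> y ys; rewrite inE ys orbT.
have subR (s : seq nat) x : {subset s <= rcons s x}.
  by move=> y ys; rewrite mem_rcons inE ys orbT.
case: (peel_inv P) => [[]|[x [y [u0 [p0 [eqU eqP e Q]]]]]|[x [y [u0 [p0 [eqU eqP e Q]]]]]].
- rewrite !size_map.
  by case: u v p {eu ev ep P le_p} => [//|? [|//]] [//|? [|//]] [//|? [|//]] *;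
    apply: peel1.
- case: u eu eqU P => [//|x1 u] eu [ex eu0] _; case: p le_p ep eqP => [//|y1 p] le_p ep [ey ep0].
  apply: peelL.
    move: e; rewrite -ey -ex -eu0 -ep0 !count_map => e.
    rewrite (@eq_in_count _ _ (preim h (r^~ (h y1)))); last first.
      by move=> z zp /=; rewrite ep ?mem_head // subL.
    rewrite e; apply: eq_in_count => z zu /=; by rewrite eu ?mem_head // subL.
  apply: IH => //; first by move=> a b /subL ? /subL ?; apply: eu.
    by move=> a b /subL ? /subL ?; apply: ep.
  by rewrite eu0 ep0.
- case/lastP: v ev eqU P => [|v x1] ev; first by case: u0 {Q e}.
  rewrite !map_rcons => /rcons_inj [eu0 ex]; case/lastP: p le_p ep eqP => [|p y1] le_p ep.
    by case: p0 {Q e}.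
  rewrite !map_rcons => /rcons_inj [ep0 ey] _.
  have hd (s : seq nat) z : z \in rcons s z by rewrite mem_rcons mem_head.
  apply: peelR.
    move: e; rewrite -ey -eu0 -ep0 -ex !count_map => e.
    rewrite (@eq_in_count _ _ (preim h (r (h y1)))); last first.
      by move=> z zp /=; rewrite ep // subR.
    rewrite e; apply: eq_in_count => z zu /=; by rewrite ev // subR.
  apply: IH => //; first by move: le_p; rewrite size_rcons.
    by move=> a b /subR ? /subR ?; apply: ev.
    by move=> a b /subR ? /subR ?; apply: ep.
  by rewrite eu0 ep0.
Qed.

(** By totality, a letter not below [y] is [y] itself or above it, hence above [z]. *)
Lemma size_le_count_below_above (r : rel nat) (y z : nat) (s : seq nat) :
  strict_order r -> r z y -> size s <= count (r^~ y) s + count (r z) s.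
Proof.
case=> irr tr tot zy; rewrite -(count_predC (r^~ y)) leq_add2l.
apply: sub_count => e /= ey; case: (eqVneq e y) => [->//|/tot].
by rewrite (negPf ey) /= => /(tr _ _ _ zy).
Qed.

(* If the last letter z of [p] were below its first letter y, the two count
   conditions would ask for more letters than [p] has; so z is not below y, and
   deletions at the two ends commute. *)
Lemma peel_head (r : rel nat) (a : nat) (u v p : seq nat) : strict_order r ->
  peel r (a :: u) v p -> count (r^~ a) u < size u ->
  exists y p', [/\ p = y :: p', count (r^~ y) p' = count (r^~ a) u & peel r u v p'].
Proof.
move=> so; move E : (a :: u) => au P; elim: P a u E => //.
- by move=> ? ? ? a u' [_ ->].
- by move=> x y u' v' p' e h _ a ? [-> ->] _; exists y, p'.
move=> b z {}au v' p' e h IH a u E lt; subst au.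
have [y [q [ep ey hq]]] := IH _ _ erefl lt; subst p'.
have [_ _ sz] := peel_size h; have := count_size (r b) v' => le.
move: e sz => /=; case zy: (r z y) => /= e sz.
  by have := size_le_count_below_above q so zy; lia.
exists y, (rcons q z); split=> //; first by rewrite -cats1 count_cat /= zy ey; lia.
by apply: peelR.
Qed.

(** The counting argument of [peel_head], for a left deletion followed by a right one: the two may
    be done in the other order. *)
Lemma peel_swap_ends (r : rel nat) (a b y z : nat) (u v p : seq nat) :
  strict_order r -> peel r u v p ->
  count (r^~ y) (rcons p z) = count (r^~ a) u -> count (r^~ a) u < size u ->
  count (r z) p = count (r b) v ->
  count (r^~ y) p = count (r^~ a) u /\ count (r z) (y :: p) = count (r b) v.
Proof.
move=> so h; rewrite -cats1 count_cat /= => ey lt ez.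
have [_ _ sz] := peel_size h; have := count_size (r b) v => le.
move: ey; case zy: (r z y) => /= ey; last by split; lia.
by have := size_le_count_below_above p so zy; lia.
Qed.

(** Right deletions keep [u] and the first letter of [p] and can only lower the rank of that letter;
    a left deletion or the base case finally asks for equal ranks. *)
Lemma peel_head_count (r : rel nat) (a y : nat) (u v p : seq nat) :
  peel r (a :: u) v (y :: p) -> count (r^~ a) u <= count (r^~ y) p.
Proof.
move Eu : (a :: u) => au; move Ep : (y :: p) => yp P; elim: P a u y p Eu Ep.
- by move=> ? ? ? a u' y p' [_ ->] [_ ->].
- by move=> x y u v' p' e _ _ ? ? ? ? [-> ->] [-> ->]; rewrite e.
move=> b z au' v' p' _ h IH a u y p E; subst au'.
case: p' h IH => [|y' p'] h IH; first by have [] := peel_size h => /= *; lia.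
by case=> -> ->; rewrite -cats1 count_cat (leq_trans (IH _ _ _ _ erefl erefl)) ?leq_addr.
Qed.


Lemma eq_count_sub (T : eqType) (P Q : pred T) (s : seq T) :
  {in s, subpred P Q} -> count P s = count Q s -> {in s, P =1 Q}.
Proof.
elim: s => [//|x s IH] sub /= e.
have subs : {in s, subpred P Q} by move=> y ys; apply: sub; rewrite inE ys orbT.
have le : count P s <= count Q s.
  rewrite (@eq_in_count _ P (predI P Q)); first by apply: sub_count => y /andP[].
  by move=> y /subs /=; case: (P y) => // ->.
have PQx : P x = Q x.
  have := sub x (mem_head _ _); move: e le.
  by case: (P x) => [|]; case: (Q x) => //; [move=> _ _ /(_ isT) | lia].
move=> y; rewrite inE => /predU1P [->//|ys]; apply: (IH subs) => //.
by move: e; rewrite PQx; lia.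
Qed.

(** Deletions elsewhere do not notice the swap, since counts ignore the order of letters. By
    induction everything reduces to the case where the two neighbours stand first and two left
    deletions have to be exchanged. *)
Lemma peel_adjacent (r : rel nat) (a b x y : nat) (u1 u2 v p1 p2 : seq nat) :
  strict_order r -> size u1 = size p1 -> uniq (p1 ++ x :: y :: p2) ->
  peel r (u1 ++ a :: b :: u2) v (p1 ++ x :: y :: p2) ->
  (r a b -> r x y /\ peel r (u1 ++ b :: a :: u2) v (p1 ++ y :: x :: p2)) /\
  (r b a -> r y x -> peel r (u1 ++ b :: a :: u2) v (p1 ++ y :: x :: p2)).
Proof.
move=> so; case: (so) => irr tr tot.
have asym c d : r c d -> r d c = false.
  by move=> cd; apply/negP => dc; have := tr _ _ _ cd dc; rewrite irr.
have mono c d s : r c d -> count (r^~ c) s <= count (r^~ d) s.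
  by move=> cd; apply: sub_count => e /= ec; apply: tr ec cd.
have swapc (P : pred nat) c d s : count P (c :: d :: s) = count P (d :: c :: s).
  by rewrite /= addnCA.
have [k] := ubnP (size p2 + size p1); elim: k => // k IH in u1 u2 v p1 p2 *.
rewrite ltnS => le_k eq_sz un P.
(* The first deletion is on the right. It cannot reach [x] or [y], because after it [p] still has at
   least as many letters as [u]. *)
have fromR c z v' p' : p1 ++ x :: y :: p2 = rcons p' z -> v = rcons v' c ->
    count (r z) p' = count (r c) v' -> peel r (u1 ++ a :: b :: u2) v' p' ->
    (r a b -> r x y /\ peel r (u1 ++ b :: a :: u2) v (p1 ++ y :: x :: p2)) /\
    (r b a -> r y x -> peel r (u1 ++ b :: a :: u2) v (p1 ++ y :: x :: p2)).
  move=> ep ev ez Q; have [_ v'0] := peel_size Q.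
  have := congr1 size ep; rewrite !size_cat size_rcons /= => e1 e2.
  case/lastP: p2 => [|p2 z'] in le_k un P ep e1 *; first by move: e1 e2 => /=; lia.
  move: ep; rewrite -!rcons_cons -!rcons_cat => /rcons_inj [ep ez']; subst p' z'.
  have un' : uniq (p1 ++ x :: y :: p2).
    by move: un; rewrite -!rcons_cons -!rcons_cat rcons_uniq => /andP[].
  have [|H1 H2] := IH u1 u2 v' p1 p2 _ eq_sz un' Q; first by move: le_k; rewrite size_rcons; lia.
  have cz : count (r z) (p1 ++ y :: x :: p2) = count (r c) v'.
    by rewrite -ez !count_cat swapc.
  by subst v; split=> [/H1 [xy Q']|/H2 Q' /Q' {}Q']; [split=> // | ]; apply: peelR.
case: (peel_inv P) => [[]|[x0 [y0 [u' [p' [eu ep e Q]]]]]|[c [z [v' [p' [ev ep e Q]]]]]].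
- by rewrite size_cat /=; lia.
- case: u1 p1 => [|a1 u1] [|x1 p1] //= in IH le_k eq_sz un P fromR eu ep *.
    case: eu ep => ? ? [? ?]; subst x0 y0 u' p'.
    have neq_xy : x != y by move: un; rewrite /= inE; case: eqVneq.
    (* If both neighbours go by left deletions, exchanging these two deletions settles both
       clauses. *)
    have LL : count (r^~ y) p2 = count (r^~ b) u2 -> peel r u2 v p2 ->
      (r a b -> r x y /\ peel r (b :: a :: u2) v (y :: x :: p2)) /\
      (r b a -> r y x -> peel r (b :: a :: u2) v (y :: x :: p2)).
      move=> e2 Q2; split=> [ab|ba yx].
        have xy : r x y.
          have := tot _ _ neq_xy; case: (r x y) => //= yx.
          by have := mono _ _ p2 yx; have := mono _ _ u2 ab; move: e; rewrite /= yx (asym _ _ ab); lia.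
        split=> //; apply: peelL; first by rewrite /= xy ab e2.
        by apply: peelL Q2; move: e; rewrite /= (asym _ _ ab) (asym _ _ xy).
      apply: peelL; first by rewrite /= (asym _ _ ba) (asym _ _ yx) e2.
      by apply: peelL Q2; move: e; rewrite /= ba yx => -[].
    (* [peel_head] provides the second left deletion unless [b] is above all of [u2]. In that
       remaining case, the number of letters of [p2] below [y] is only known to be at least
       [size u2]. *)
    case: (ltnP (count (r^~ b) u2) (size u2)) => [lt_b|ge_b].
      by have [? [? [[<- <-] ey Q2]]] := peel_head so Q lt_b; apply: LL.
    have cb : count (r^~ b) u2 = size u2 by apply/eqP; rewrite eqn_leq count_size.
    have le_y := peel_head_count Q; rewrite cb in le_y.
    split=> [ab|ba yx].
      (* Otherwise more than [size u2] letters would lie below [x], while at most [size u2] lie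
         below [a], since [b] does not. *)
      have xy : r x y.
        have := tot _ _ neq_xy; case: (r x y) => //= yx.
        by have := mono _ _ p2 yx; have := count_size (r^~ a) u2; move: e; rewrite /= yx (asym _ _ ab); lia.
      split=> //.
      case: (peel_inv Q) => [[]|[x0 [y0 [u' [p' [[? ?] [? ?] e' Q']]]]]|[c [z [v' [p' [ev ep e' Q']]]]]].
      + case: (u2) (p2) (v) => [|//] [|//] [//|c [|//]] _ _ _; apply: peelL; last exact: peel1.
        by rewrite /= ab xy.
      + by subst x0 y0 u' p'; case: (LL e' Q') => /(_ ab) [].
      (* The next deletion is on the right; [peel_swap_ends] moves it to the front, where [fromR]
         applies. *)
      + case: p' => [|y' p'] in ep e' Q' *; first by have [] := peel_size Q' => /= *; lia.
        case: ep => ? ep; subst y'.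
        have lt_a : count (r^~ a) (b :: u2) < size (b :: u2).
          by rewrite /= (asym _ _ ab) ltnS count_size.
        have e0 : count (r^~ x) (rcons (y :: p') z) = count (r^~ a) (b :: u2).
          by rewrite -e ep.
        have [e1 e2] := peel_swap_ends so Q' e0 lt_a e'.
        have [H _] : (r a b -> r x y /\ peel r (b :: a :: u2) v (y :: x :: p2)) /\
          (r b a -> r y x -> peel r (b :: a :: u2) v (y :: x :: p2)).
          by apply: fromR ev e2 _; [rewrite ep | apply: peelL Q'].
        by case: (H ab).
    (* Now [a] and [b] both lie above all of [u2], and no letter of [p2] lies between [y] and [x].
       Replacing [b] by [a] and [y] by [x] in [Q] therefore changes no comparison, and [b] and [y]
       can be deleted first. *)
    have ca : count (r^~ a) u2 = size u2.
      by apply/eqP; rewrite eqn_leq count_size -cb mono.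
    have cx : count (r^~ x) p2 = size u2 by move: e; rewrite /= ba yx ca => -[].
    have cy : count (r^~ y) p2 = count (r^~ x) p2.
      by have := mono _ _ p2 yx; lia.
    apply: peelL; first by rewrite /= (asym _ _ ba) (asym _ _ yx) cb cy cx.
    have u2b : {in u2, forall c, r c b} by apply/allP; rewrite all_count cb.
    have u2a : {in u2, forall c, r c a} by apply/allP; rewrite all_count ca.
    have bu2 : b \notin u2 by apply/negP => /u2b; rewrite irr.
    have [xp2 yp2] : x \notin p2 /\ y \notin p2.
      by move: un => /= /and3P[]; rewrite inE negb_or => /andP[].
    have eqxy : {in p2, (r^~ y) =1 (r^~ x)}.
      by apply: eq_count_sub cy => c _ /= cy'; apply: tr cy' yx.
    have eqyx : {in p2, r y =1 r x}.
      move=> c cp; have /tot := memPn xp2 c cp; have /tot := memPn yp2 c cp.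
      have /= := eqxy c cp; case cx': (r c x) => cy' /=; first by rewrite (asym _ _ cx') (asym _ _ cy').
      by rewrite cy' /= => -> ->.
    pose f c := if c == b then a else c; pose h c := if c == y then x else c.
    have -> : a :: u2 = map f (b :: u2).
      by rewrite /= {1}/f eqxx map_id_in // => c cu; rewrite /f (negPf (memPn bu2 c cu)).
    have -> : x :: p2 = map h (y :: p2).
      by rewrite /= {1}/h eqxx map_id_in // => c cu; rewrite /h (negPf (memPn yp2 c cu)).
    rewrite -(map_id v); apply: (@peel_map r id f id id id h) => //; last by rewrite !map_id.
      move=> c d; rewrite !inE /f => /predU1P[->|cu] /predU1P[->|du].
      + by rewrite eqxx !irr.
      + by rewrite eqxx (negPf (memPn bu2 d du)) (asym _ _ (u2a d du)) (asym _ _ (u2b d du)).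
      + by rewrite eqxx (negPf (memPn bu2 c cu)) u2a ?u2b.
      + by rewrite (negPf (memPn bu2 c cu)) (negPf (memPn bu2 d du)).
    move=> c d; rewrite !inE /h => /predU1P[->|cu] /predU1P[->|du].
    + by rewrite eqxx !irr.
    + by rewrite eqxx (negPf (memPn yp2 d du)) eqyx.
    + by rewrite eqxx (negPf (memPn yp2 c cu)); apply: eqxy.
    + by rewrite (negPf (memPn yp2 c cu)) (negPf (memPn yp2 d du)).
  (* The letter deleted on the left stands in front of the pair, and its rank does not see the
     swap. *)
  case: eu ep => ? ? [? ?]; subst x0 y0 u' p'; case: eq_sz => eq_sz.
  have un' : uniq (p1 ++ x :: y :: p2) by case/andP: un.
  have [|H1 H2] := IH u1 u2 v p1 p2 _ eq_sz un' Q; first lia.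
  have e' : count (r^~ x1) (p1 ++ y :: x :: p2) = count (r^~ a1) (u1 ++ b :: a :: u2).
    by move: e; rewrite !count_cat swapc [in RHS]swapc => ->; rewrite swapc.
  by split=> [/H1 [xy Q']|/H2 Q' /Q' {}Q']; [split=> //|]; apply: peelL.
- by apply: fromR ep ev e Q.
Qed.

(** * Peeling words of actual values *)


Lemma rank_inj (r : rel nat) (s : seq nat) (x y : nat) : strict_order r ->
  x \in s -> y \in s -> count (r^~ x) s = count (r^~ y) s -> x = y.
Proof.
case=> irr tr tot xs ys e; apply/eqP/negPn/negP => /tot /orP[xy|yx].
  have sub : {in s, subpred (r^~ x) (r^~ y)} by move=> z _ /= zx; apply: tr zx xy.
  by have /= := eq_count_sub sub e xs; rewrite xy irr.
have sub : {in s, subpred (r^~ y) (r^~ x)} by move=> z _ /= zx; apply: tr zx yx.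
by have /= := eq_count_sub sub (esym e) ys; rewrite yx irr.
Qed.

(** The word [u] is a down-set of the letters of [p], and an up-set when [r] is flipped. A letter of
    [u] then has the same rank in [u] and in [p], which turns rank conditions into equalities of
    letters. *)
Definition lower_part (r : rel nat) (u p : seq nat) : Prop :=
  [/\ uniq u, uniq p, {subset u <= p} & {in p & u, forall q a, r q a -> q \in u}].

Lemma lower_part_count (r : rel nat) (u p : seq nat) (a : nat) :
  lower_part r u p -> a \in u -> count (r^~ a) p = count (r^~ a) u.
Proof.
case=> uu up sub low au; rewrite -!size_filter; apply/perm_size/uniq_perm.
- exact: filter_uniq.
- exact: filter_uniq.
move=> q; rewrite !mem_filter; case qa: (r q a) => //=.
by apply/idP/idP => [qp|/sub//]; apply: low au qa.
Qed.

Lemma lower_part_head (r : rel nat) (u p : seq nat) (a y : nat) : strict_order r ->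
  lower_part r (a :: u) (y :: p) -> count (r^~ y) p = count (r^~ a) u -> y = a.
Proof.
move=> so low e; apply: (rank_inj so) (mem_head y p) _ _; first by case: low => _ _ -> //; rewrite mem_head.
rewrite (lower_part_count low (mem_head a u)) /=.
by case: so => irr _ _; rewrite !irr.
Qed.

Lemma lower_part_behead (r : rel nat) (u p : seq nat) (a : nat) :
  lower_part r (a :: u) (a :: p) -> lower_part r u p.
Proof.
case=> /andP[au uu] /andP[ap up] sub low; split=> // [x xu|q b qp bu qb].
  have := sub x; rewrite !inE xu orbT => /(_ isT) /predU1P[xa|//].
  by rewrite -xa xu in au.
have := low q b; rewrite !inE qp bu !orbT => /(_ isT isT qb) /predU1P[qa|//].
by rewrite -qa qp in ap.
Qed.

Lemma lower_part_behead_notin (r : rel nat) (u p : seq nat) (a : nat) :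
  a \notin u -> lower_part r u (a :: p) -> lower_part r u p.
Proof.
move=> au [uu /andP[ap up] sub low]; split=> // [x xu|q b qp bu].
  by have := sub x xu; rewrite inE => /predU1P[xa|//]; rewrite -xa xu in au.
by apply: low => //; rewrite inE qp orbT.
Qed.

Lemma lower_part_rev (r : rel nat) (u p : seq nat) :
  lower_part r u p -> lower_part r (rev u) (rev p).
Proof.
case=> uu up sub low; split; rewrite ?rev_uniq //.
  by move=> x; rewrite !mem_rev; apply: sub.
by move=> q a; rewrite !mem_rev; apply: low.
Qed.

(** Each letter of the common prefix has equal ranks on both sides, so the prefix can be deleted
    from the left letter by letter. *)
Lemma peel_prefix (r : rel nat) (s u v p : seq nat) : strict_order r ->
  lower_part r (s ++ u) (s ++ p) -> peel r u v p -> peel r (s ++ u) v (s ++ p).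
Proof.
move=> so; elim: s => [//|a s IH] /= low Q; apply: peelL; last first.
  exact: IH (lower_part_behead low) Q.
have := lower_part_count low (mem_head a _); rewrite /=.
by case: so => irr _ _; rewrite irr.
Qed.

(** A letter of [s] lies below [M] and so is not maximal: [peel_head] deletes it first, and
    [lower_part_head] identifies it with the first letter of [p]. *)
Lemma peel_max_last (r : rel nat) (s v p : seq nat) (M : nat) : strict_order r ->
  lower_part r (rcons s M) p -> all (r^~ M) s -> peel r (rcons s M) v p ->
  exists q, p = s ++ q /\ peel r [:: M] v q.
Proof.
move=> so; case: (so) => irr tr _.
elim: s p => [|a s IH] p low; first by exists p.
move=> /= /andP[aM sM] Q.
have lt : count (r^~ a) (rcons s M) < size (rcons s M).
  rewrite -cats1 count_cat size_cat /= addn0 addn1.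
  case Ma: (r M a); first by have := tr _ _ _ aM Ma; rewrite irr.
  by rewrite addn0 ltnS count_size.
have [y [p' [ep e Q']]] := peel_head so Q lt; subst p.
have ya := lower_part_head so low e; subst y.
by have [q [-> Qq]] := IH _ (lower_part_behead low) sM Q'; exists q.
Qed.

(** A left deletion would empty [u], so only right deletions occur, and they match [v] and [p] rank
    by rank from the end. *)
Lemma peel_single_eq (r : rel nat) (a : nat) (v p : seq nat) : strict_order r ->
  peel r [:: a] v p -> perm_eq v p -> v = p.
Proof.
move=> so; move E : [:: a] => u P; elim: P E => //.
- by move=> ? b c _ /perm_mem /(_ b); rewrite !inE eqxx => /esym /eqP ->.
- by move=> x y u' v' p' _ h _ [_ eu]; have [] := peel_size h; rewrite -eu.
move=> y z u' v' p' e _ IH /IH {}IH pe.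
have zy : z = y.
  have inr s x : x \in rcons s x by rewrite mem_rcons mem_head.
  apply: (rank_inj (strict_order_flip so) (s := rcons p' z)) => //.
    by rewrite -(perm_mem pe).
  have /permP /(_ (r y)) <- := pe.
  by case: so => irr _ _; rewrite -!cats1 !count_cat /= !irr !addn0 e.
rewrite zy IH //; move: pe; rewrite zy -!cats1.
by rewrite perm_cat2r.
Qed.

Lemma peel_single_refl (r : rel nat) (a : nat) (v : seq nat) :
  0 < size v -> peel r [:: a] v v.
Proof.
elim/last_ind: v => [//|[|b v] y IH _]; first exact: peel1.
by apply: peelR => //; apply: IH.
Qed.

(** Here [M] is the maximum of the first word and the minimum of the second. Deletions are followed
    until one removes [M]: from the left, this shows that [p] begins with [u1] and [M]; from the
    right, that it ends with [M] and [w2]. *)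
Lemma peel_split (r : rel nat) (M : nat) (u1 u2 w1 w2 p : seq nat) :
  strict_order r -> 0 < size u2 -> 0 < size w1 ->
  lower_part r (u1 ++ M :: u2) p ->
  lower_part (fun x y => r y x) (w1 ++ M :: w2) p ->
  all (r^~ M) (u1 ++ u2) -> all (r M) (w1 ++ w2) ->
  peel r (u1 ++ M :: u2) (w1 ++ M :: w2) p ->
  (exists q, p = u1 ++ M :: q /\ peel r u2 (w1 ++ M :: w2) q) \/
  (exists q, p = q ++ M :: w2 /\ peel r (u1 ++ M :: u2) w1 q).
Proof.
have [k] := ubnP (size p); elim: k => // k IH in r u1 u2 w1 w2 p *.
rewrite ltnS => le_k so u20 w10 lowu loww maxM minM P.
(* Stated for any order [r'], because a right deletion becomes a left one after reversing the words
   and flipping the order. *)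
have viaL (r' : rel nat) (s1 s2 t1 t2 p0 : seq nat) x y s p' :
    size p0 <= k -> strict_order r' -> 0 < size s2 -> 0 < size t1 ->
    lower_part r' (s1 ++ M :: s2) p0 ->
    lower_part (fun x y => r' y x) (t1 ++ M :: t2) p0 ->
    all (r'^~ M) (s1 ++ s2) -> all (r' M) (t1 ++ t2) ->
    s1 ++ M :: s2 = x :: s -> p0 = y :: p' ->
    count (r'^~ y) p' = count (r'^~ x) s -> peel r' s (t1 ++ M :: t2) p' ->
    (exists q, p0 = s1 ++ M :: q /\ peel r' s2 (t1 ++ M :: t2) q) \/
    (exists q, p0 = q ++ M :: t2 /\ peel r' (s1 ++ M :: s2) t1 q).
  move=> {u1 u2 w1 w2 p le_k u20 w10 lowu loww maxM minM P} le_k so' s20 t10 low low' mx mn es ep e Q.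
  case: (so') => irr tr _.
  rewrite es ep in low; have yx := lower_part_head so' low e; subst y p0.
  (* With [s1] empty the deleted letter is [M] itself, which gives the first alternative. *)
  case: s1 => [|a s1] in mx es *; case: es => ? ?; subst x s; first by left; exists p'.
  have aM : r' a M by case/andP: mx.
  have a_notin : a \notin t1 ++ M :: t2.
    rewrite mem_cat inE orbCA -mem_cat negb_or; apply/andP; split.
      by apply/negP => /eqP aM'; move: aM; rewrite aM' irr.
    by apply/negP => /(allP mn) Ma; have := tr _ _ _ aM Ma; rewrite irr.
  have mx' : all (r'^~ M) (s1 ++ s2) by case/andP: mx.
  have [] := IH r' s1 s2 t1 t2 p' le_k so' s20 t10 (lower_part_behead low)
     (lower_part_behead_notin a_notin low') mx' mn Q.
    by case=> q [-> Qq]; left; exists q.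
  case=> q [ep Qq]; right; exists (a :: q); split; first by rewrite ep.
  (* The letters [M :: t2] that [p'] has beyond [q] are all above [a], so [a] has the same rank in
     [q] as in [p']. *)
  apply: peelL => //; rewrite -e ep count_cat -[LHS]addn0; congr addn.
  apply/esym/eqP; rewrite -leqn0 leqNgt -has_count; apply/hasPn => z.
  rewrite inE => zM; apply/negP => za; have zM' := tr _ _ _ za aM.
  case/predU1P: zM => [zM|zt]; first by move: zM'; rewrite zM irr.
  have := allP mn z; rewrite mem_cat zt orbT => /(_ isT) Mz.
  by have := tr _ _ _ Mz zM'; rewrite irr.
have revE s1 s2 : rev (s1 ++ M :: s2) = rev s2 ++ M :: rev s1.
  by rewrite rev_cat rev_cons cat_rcons.
case: (peel_inv P) => [[]|[x [y [u' [p' [eu ep e Q]]]]]|[x [y [w' [p' [ew ep e Q]]]]]].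
- by rewrite size_cat /=; lia.
- exact: viaL eu ep e Q.
have Ew : rev w2 ++ M :: rev w1 = x :: rev w' by rewrite -revE ew rev_rcons.
have Ep : rev p = y :: rev p' by rewrite ep rev_rcons.
have le_k' : size (rev p) <= k by rewrite size_rev.
have w10' : 0 < size (rev w1) by rewrite size_rev.
have u20' : 0 < size (rev u2) by rewrite size_rev.
have := lower_part_rev loww; rewrite revE => loww'.
have := lower_part_rev lowu; rewrite revE => lowu'.
have minM' : all (r M) (rev w2 ++ rev w1) by rewrite -rev_cat all_rev.
have maxM' : all (r^~ M) (rev u2 ++ rev u1) by rewrite -rev_cat all_rev.
have e' : count (r y) (rev p') = count (r x) (rev w') by rewrite !count_rev.
have := peel_rev Q; rewrite revE => Q'.
have [] := viaL (fun x y => r y x) _ _ _ _ _ _ _ _ _ le_k' (strict_order_flip so)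
  w10' u20' loww' lowu' minM' maxM' Ew Ep e' Q'.
  case=> q [eq Qq]; right; exists (rev q); split.
    by rewrite -[p]revK eq revE revK.
  by have := peel_rev Qq; rewrite revE !revK.
case=> q [eq Qq]; left; exists (rev q); split.
  by rewrite -[p]revK eq revE revK.
by have := peel_rev Qq; rewrite revE !revK.
Qed.

(** * Flattening and relabelling *)


Lemma rank_mono (s : seq nat) :
  {in s &, forall x y, (count (ltn^~ x) s < count (ltn^~ y) s) = (x < y)}.
Proof.
have le x y : x <= y -> count (ltn^~ x) s <= count (ltn^~ y) s.
  by move=> xy; apply: sub_count => z /= zx; apply: leq_trans zx xy.
move=> x y xs ys; case: (ltnP x y) => xy; last by apply/negbTE; rewrite -leqNgt le.
rewrite ltn_neqAle le 1?ltnW // andbT; apply/eqP => /(rank_inj strict_order_ltn xs ys) e.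
by rewrite e ltnn in xy.
Qed.

Lemma fl_mono (s : seq nat) :
  {in s &, forall x y,
    ((count (fun z => z < x) s).+1 < (count (fun z => z < y) s).+1) = (x < y)}.
Proof. by move=> x y xs ys; rewrite ltnS; apply: rank_mono. Qed.

Lemma rank_size (s : seq nat) (x : nat) : x \in s -> count (ltn^~ x) s < size s.
Proof.
move=> xs; rewrite ltn_neqAle count_size andbT -all_count; apply/allPn.
by exists x => //=; rewrite ltnn.
Qed.

Lemma perm_fl (s : seq nat) : uniq s -> perm_eq (fl s) (iota 1 (size s)).
Proof.
move=> us.
have ufl : uniq (fl s).
  rewrite map_inj_in_uniq // => x y xs ys [e].
  exact: rank_inj strict_order_ltn xs ys e.
apply: uniq_perm; rewrite ?iota_uniq //.
have [||_ //] := uniq_min_size ufl (s2 := iota 1 (size s)).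
  by move=> _ /mapP[x xs ->]; rewrite mem_iota add1n /= !ltnS rank_size.
by rewrite size_iota size_map.
Qed.

(** For [c] increasing and as long as a repetition-free [s], this renames [s] along the
    order-preserving bijection onto [c]. With [c] a complement it is the map φ or ψ of the slash
    products. *)
Definition relabel (c s : seq nat) : seq nat :=
  [seq nth 0 c (count (fun y => y < x) s) | x <- s].

Lemma size_relabel (c s : seq nat) : size (relabel c s) = size s.
Proof. exact: size_map. Qed.

Lemma relabel_mono (c s : seq nat) : sorted ltn c -> size c = size s ->
  {in s &, forall x y, (nth 0 c (count (fun z => z < x) s)
    < nth 0 c (count (fun z => z < y) s)) = (x < y)}.
Proof.
move=> sc sz x y xs ys; rewrite -(rank_mono xs ys).
have /= nth_lt := sorted_ltn_nth ltn_trans 0 sc.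
have := rank_size xs; have := rank_size ys; rewrite -sz => ly lx.
case: (ltngtP (count _ s) (count _ s)) => [/nth_lt->//|/nth_lt lt|->]; last exact: ltnn.
by apply/negbTE; rewrite -leqNgt ltnW // lt.
Qed.

Lemma perm_relabel (c s : seq nat) : sorted ltn c -> size c = size s -> uniq s ->
  perm_eq (relabel c s) c.
Proof.
move=> sc sz us; have uc : uniq c by apply: sorted_uniq sc; [exact: ltn_trans | exact: ltnn].
have ur : uniq (relabel c s).
  rewrite map_inj_in_uniq // => x y xs ys e.
  case: (ltngtP x y) => // lt.
    by have := relabel_mono sc sz xs ys; rewrite e ltnn lt.
  by have := relabel_mono sc sz ys xs; rewrite e ltnn lt.
apply: uniq_perm => //.
have [||_ //] := uniq_min_size ur (s2 := c); last by rewrite size_relabel sz.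
by move=> _ /mapP[x xs ->]; rewrite mem_nth // sz rank_size.
Qed.

Lemma nth_rank (c : seq nat) (x : nat) : sorted ltn c -> x \in c ->
  nth 0 c (count (ltn^~ x) c) = x.
Proof.
elim: c => [//|y c IH] /= sc; have := order_path_min ltn_trans sc => /allP lt.
rewrite inE => /predU1P[->|xc].
  rewrite ltnn add0n (_ : count _ _ = 0) //.
  by apply/eqP; rewrite -leqn0 leqNgt -has_count; apply/hasPn => z /lt /=; lia.
by rewrite (lt x xc) /= IH // (path_sorted sc).
Qed.

Lemma relabel_fl (c s : seq nat) : sorted ltn c -> perm_eq s c -> relabel c (fl s) = s.
Proof.
move=> sc pe; rewrite /relabel /fl -map_comp -[RHS]map_id; apply/eq_in_map => x xs /=.
rewrite count_map (@eq_in_count _ _ (ltn^~ x)); last first.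
  by move=> y ys /=; apply: fl_mono.
by rewrite (permP pe) nth_rank // -(perm_mem pe).
Qed.

Definition missing (N : nat) (a : seq nat) : seq nat := [seq y <- iota 1 N | y \notin a].

Lemma missing_sorted (N : nat) (a : seq nat) : sorted ltn (missing N a).
Proof. apply: sorted_filter; [exact: ltn_trans | exact: iota_ltn_sorted]. Qed.

Lemma perm_cat_missing (N : nat) (a : seq nat) : uniq a -> {subset a <= iota 1 N} ->
  perm_eq (a ++ missing N a) (iota 1 N).
Proof.
move=> ua sub; rewrite perm_sym -(perm_filterC (mem a)) perm_cat2r.
apply: uniq_perm; rewrite ?filter_uniq ?iota_uniq // => x.
by rewrite mem_filter /=; case xa: (x \in a) => //=; apply: sub.
Qed.

Lemma size_missing (N : nat) (a : seq nat) : uniq a -> {subset a <= iota 1 N} ->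
  size (missing N a) = N - size a.
Proof.
move=> ua /(perm_cat_missing ua) /perm_size; rewrite size_cat size_iota.
by move/(congr1 (subn^~ (size a))); rewrite addKn.
Qed.

Lemma perm_missing (N : nat) (a s : seq nat) :
  perm_eq (a ++ s) (iota 1 N) -> perm_eq s (missing N a).
Proof.
move=> pe; have := iota_uniq 1 N; rewrite -(perm_uniq pe) cat_uniq => /and3P[ua _ _].
rewrite -(perm_cat2l a) (perm_trans pe) // perm_sym perm_cat_missing //.
by move=> x xa; rewrite -(perm_mem pe) mem_cat xa.
Qed.

Lemma slash_relabel (a b : seq nat) :
  slash a b = a ++ relabel (missing (size a + size b) a) b.
Proof. by []. Qed.

Lemma bslash_relabel (a b : seq nat) :
  bslash a b = relabel (missing (size a + size b) b) a ++ b.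
Proof. by []. Qed.

Lemma peel_fl_u (u v p : seq nat) : peel ltn (fl u) v p <-> peel ltn u v p.
Proof.
split=> P.
  rewrite -[u]map_id -[v]map_id -[p]map_id.
  apply: (@peel_map ltn (fun x => (count (fun y => y < x) u).+1) id id id id id); rewrite ?map_id //.
  by move=> x y xs ys; apply: fl_mono.
rewrite -[v]map_id -[p]map_id.
apply: (@peel_map ltn id (fun x => (count (fun y => y < x) u).+1) id id id id); rewrite ?map_id //.
by move=> x y xs ys; apply/esym/fl_mono.
Qed.

Lemma peel_fl_v (u v p : seq nat) : peel ltn u (fl v) p <-> peel ltn u v p.
Proof.
split=> P.
  rewrite -[u]map_id -[v]map_id -[p]map_id.
  apply: (@peel_map ltn id id (fun x => (count (fun y => y < x) v).+1) id id id); rewrite ?map_id //.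
  by move=> x y xs ys; apply: fl_mono.
rewrite -[u]map_id -[p]map_id.
apply: (@peel_map ltn id id id (fun x => (count (fun y => y < x) v).+1) id id); rewrite ?map_id //.
by move=> x y xs ys; apply/esym/fl_mono.
Qed.

Lemma peel_fl_p (u v p : seq nat) : peel ltn u v (fl p) <-> peel ltn u v p.
Proof.
split=> P.
  rewrite -[u]map_id -[v]map_id -[p]map_id.
  apply: (@peel_map ltn id id id id (fun x => (count (fun y => y < x) p).+1) id); rewrite ?map_id //.
  by move=> x y xs ys; apply: fl_mono.
rewrite -[u]map_id -[v]map_id.
apply: (@peel_map ltn id id id id id (fun x => (count (fun y => y < x) p).+1)); rewrite ?map_id //.
by move=> x y xs ys; apply/esym/fl_mono.
Qed.

Lemma peel_relabel (c u v p : seq nat) : sorted ltn c -> size c = size p ->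
  peel ltn u v p -> peel ltn u v (relabel c p).
Proof.
move=> sc sz P; rewrite -[u]map_id -[v]map_id.
apply: (@peel_map ltn id id id id id (fun x => nth 0 c (count (fun y => y < x) p)));
  rewrite ?map_id //.
by move=> x y xs ys; apply/esym/relabel_mono.
Qed.

Lemma peel_wup (m : nat) (u v p : seq nat) : peel ltn u (wup v m) p <-> peel ltn u v p.
Proof.
split=> P.
  rewrite -[u]map_id -[v]map_id -[p]map_id.
  apply: (@peel_map ltn id id (addn^~ m) id id id); rewrite ?map_id // => x y _ _.
  exact: ltn_add2r.
rewrite -[u]map_id -[p]map_id.
apply: (@peel_map ltn id id id (addn^~ m) id id); rewrite ?map_id // => x y _ _.
exact/esym/ltn_add2r.
Qed.


(** * The recursion for S(u, v) and the peeling relation *)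

Lemma perm_wup (m k : nat) (v : seq nat) :
  perm_eq v (iota 1 k) -> perm_eq (wup v m) (iota m.+1 k).
Proof.
move=> /(perm_map (addn^~ m)); rewrite /wup; congr perm_eq.
by rewrite -{1}(addn1 m) iotaDl; apply: eq_map => i; rewrite addnC.
Qed.

Lemma fl_wup (s : seq nat) (m : nat) : fl (wup s m) = fl s.
Proof.
rewrite /fl /wup -map_comp; apply: eq_map => x /=; rewrite count_map.
by congr _.+1; apply: eq_count => y /=; rewrite ltn_add2r.
Qed.

Lemma lower_part_initial (k N : nat) (u p : seq nat) : k <= N ->
  perm_eq u (iota 1 k) -> perm_eq p (iota 1 N) -> lower_part ltn u p.
Proof.
move=> kN pu pp; split; rewrite ?(perm_uniq pu) ?(perm_uniq pp) ?iota_uniq //.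
  by move=> x; rewrite (perm_mem pu) (perm_mem pp) !mem_iota; lia.
by move=> q a; rewrite !(perm_mem pu) (perm_mem pp) !mem_iota /=; lia.
Qed.

Lemma lower_part_final (k l N : nat) (w p : seq nat) : k + l = N ->
  perm_eq w (iota k.+1 l) -> perm_eq p (iota 1 N) ->
  lower_part (fun x y => ltn y x) w p.
Proof.
move=> kN pw pp; split; rewrite ?(perm_uniq pw) ?(perm_uniq pp) ?iota_uniq //.
  by move=> x; rewrite (perm_mem pw) (perm_mem pp) !mem_iota; lia.
by move=> q a; rewrite !(perm_mem pw) (perm_mem pp) !mem_iota /=; lia.
Qed.

Lemma perm_iota_max (s1 s2 : seq nat) (m : nat) :
  perm_eq (s1 ++ m.+1 :: s2) (iota 1 m.+1) -> perm_eq (s1 ++ s2) (iota 1 m).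
Proof.
have -> : iota 1 m.+1 = rcons (iota 1 m) m.+1.
  by rewrite -{1}(addn1 m) iotaD cats1 add1n.
by rewrite -[m.+1 :: s2]cat1s perm_catCA perm_sym perm_rcons perm_sym perm_cons.
Qed.

Lemma perm_iota_min (s1 s2 : seq nat) (m n : nat) :
  perm_eq (s1 ++ m :: s2) (iota m n.+1) -> perm_eq (s1 ++ s2) (iota m.+1 n).
Proof. by rewrite -[m :: s2]cat1s perm_catCA /= perm_cons. Qed.

(** Case (a) of the recursion. Once the prefix [s] is split off, a single letter of the first word
    is left, and the rest of [p] must be [w]. *)
Lemma peel_max_lastP (m n : nat) (s w p : seq nat) :
  perm_eq (rcons s m.+1) (iota 1 m.+1) -> perm_eq w (iota m.+1 n.+1) ->
  p = s ++ w <-> perm_eq p (iota 1 (m + n).+1) /\ peel ltn (rcons s m.+1) w p.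
Proof.
move=> pu pw.
have ps : perm_eq s (iota 1 m).
  by rewrite -[s]cats0; apply: perm_iota_max; rewrite cats1.
have psw : perm_eq (s ++ w) (iota 1 (m + n).+1).
  by rewrite -addnS iotaD add1n perm_cat.
split=> [->|[pp P]].
  split=> //; rewrite -cats1.
  apply: peel_prefix; first exact: strict_order_ltn.
    by rewrite cats1; apply: lower_part_initial psw; last exact: pu; lia.
  by apply: peel_single_refl; rewrite (perm_size pw) size_iota.
have low : lower_part ltn (rcons s m.+1) p.
  by apply: lower_part_initial pp; last exact: pu; lia.
have mx : all (ltn^~ m.+1) s.
  by apply/allP => x; rewrite (perm_mem ps) mem_iota /=; lia.
have [q [ep Q]] := peel_max_last strict_order_ltn low mx P.
rewrite ep -(peel_single_eq strict_order_ltn Q) //.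
by rewrite -(perm_cat2l s) -ep (perm_trans psw) // perm_sym.
Qed.

(** Case (b) of the recursion, obtained as the mirror image of case (a) by reversing the words and
    flipping the order. *)
Lemma peel_min_headP (m n : nat) (u s p : seq nat) :
  perm_eq u (iota 1 m.+1) -> perm_eq (m.+1 :: s) (iota m.+1 n.+1) ->
  p = u ++ s <-> perm_eq p (iota 1 (m + n).+1) /\ peel ltn u (m.+1 :: s) p.
Proof.
move=> pu pw; have so := strict_order_flip strict_order_ltn.
have ps : perm_eq s (iota m.+2 n) by move: pw; rewrite /= perm_cons.
have pus : perm_eq (u ++ s) (iota 1 (m + n).+1).
  by rewrite -addSn iotaD add1n perm_cat.
have low q : perm_eq q (iota 1 (m + n).+1) ->
    lower_part (fun x y => ltn y x) (rcons (rev s) m.+1) (rev q).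
  by move=> pq; rewrite -rev_cons; apply/lower_part_rev/(lower_part_final _ pw pq); lia.
split=> [->|[pp P]].
  split=> //; rewrite -[u ++ s]revK -[_ :: s]revK -{1}[u]revK.
  apply: (@peel_rev (fun x y => ltn y x)); rewrite rev_cat rev_cons -cats1.
  apply: peel_prefix => //; first by rewrite cats1 -rev_cat; apply: low.
  by apply: peel_single_refl; rewrite size_rev (perm_size pu) size_iota.
have mx : all (fun x => ltn m.+1 x) (rev s).
  by apply/allP => x; rewrite mem_rev (perm_mem ps) mem_iota /=; lia.
have := peel_rev P; rewrite rev_cons => P'.
have [q [ep Q]] := peel_max_last so (low _ pp) mx P'.
have eq : rev u = q.
  apply: (peel_single_eq so Q); rewrite -(perm_cat2l (rev s)) -ep -rev_cat.
  by rewrite perm_rev perm_sym perm_rev (perm_trans pp) // perm_sym.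
by rewrite -[p]revK ep -eq -rev_cat revK.
Qed.

(** Case (c) of the recursion. The two alternatives come from [peel_split]; the undetermined part of
    [p] is flattened to [q], and [slash] or [bslash] gives back its actual letters. *)
Lemma peel_splitP (m n : nat) (u1 u2 w1 w2 p : seq nat) :
  perm_eq (u1 ++ m.+1 :: u2) (iota 1 m.+1) ->
  perm_eq (w1 ++ m.+1 :: w2) (iota m.+1 n.+1) ->
  0 < size u2 -> 0 < size w1 ->
  perm_eq p (iota 1 (m + n).+1) /\ peel ltn (u1 ++ m.+1 :: u2) (w1 ++ m.+1 :: w2) p <->
  (exists q, [/\ perm_eq q (iota 1 (size u2 + n)),
     peel ltn (fl u2) (w1 ++ m.+1 :: w2) q & p = slash (rcons u1 m.+1) q]) \/
  (exists q, [/\ perm_eq q (iota 1 (m + size w1)),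
     peel ltn (u1 ++ m.+1 :: u2) (fl w1) q & p = bslash q (m.+1 :: w2)]).
Proof.
move=> pu pw u20 w10; have so := strict_order_ltn.
have pu' := perm_iota_max pu; have pw' := perm_iota_min pw.
have mx : all (ltn^~ m.+1) (u1 ++ u2).
  by apply/allP => x; rewrite (perm_mem pu') mem_iota /=; lia.
have mn : all (ltn m.+1) (w1 ++ w2).
  by apply/allP => x; rewrite (perm_mem pw') mem_iota /=; lia.
have low q : perm_eq q (iota 1 (m + n).+1) -> lower_part ltn (u1 ++ m.+1 :: u2) q.
  by move=> pq; apply: lower_part_initial pq; last exact: pu; lia.
have low' q : perm_eq q (iota 1 (m + n).+1) ->
    lower_part (fun x y => ltn y x) (w1 ++ m.+1 :: w2) q.
  by move=> pq; apply: lower_part_final pq; last exact: pw; lia.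
have szu : size u1 + size u2 = m by rewrite -size_cat (perm_size pu') size_iota.
have szw : size w1 + size w2 = n by rewrite -size_cat (perm_size pw') size_iota.
have uu : uniq (u1 ++ m.+1 :: u2) by rewrite (perm_uniq pu) iota_uniq.
have uw : uniq (w1 ++ m.+1 :: w2) by rewrite (perm_uniq pw) iota_uniq.
have ua : uniq (rcons u1 m.+1) by move: uu; rewrite -cat_rcons cat_uniq => /and3P[].
have ub : uniq (m.+1 :: w2) by move: uw; rewrite cat_uniq => /and3P[].
have suba : {subset rcons u1 m.+1 <= iota 1 (m + n).+1}.
  move=> x xa; have : x \in u1 ++ m.+1 :: u2 by rewrite -cat_rcons mem_cat xa.
  by rewrite (perm_mem pu) !mem_iota; lia.
have subb : {subset m.+1 :: w2 <= iota 1 (m + n).+1}.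
  move=> x xb; have : x \in w1 ++ m.+1 :: w2 by rewrite mem_cat xb orbT.
  by rewrite (perm_mem pw) !mem_iota; lia.
split=> [[pp P]|].
  have szp : size p = (m + n).+1 by rewrite (perm_size pp) size_iota.
  have [[q [ep Q]]|[q [ep Q]]] := peel_split so u20 w10 (low _ pp) (low' _ pp) mx mn P.
    rewrite -cat_rcons in ep; have pq : perm_eq q (missing (m + n).+1 (rcons u1 m.+1)).
      by apply: perm_missing; rewrite -ep.
    have sq : size q = size u2 + n.
      by move: szp szu; rewrite ep size_cat size_rcons; clear; lia.
    left; exists (fl q); split.
    - by rewrite -sq perm_fl // (perm_uniq pq) filter_uniq ?iota_uniq.
    - by apply/peel_fl_u/peel_fl_p.
    rewrite slash_relabel size_rcons (_ : size (fl q) = size q) ?size_map // sq.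
    rewrite (_ : (size u1).+1 + (size u2 + n) = (m + n).+1) ?relabel_fl ?missing_sorted //.
    by move: szu; clear; lia.
  have pq : perm_eq q (missing (m + n).+1 (m.+1 :: w2)).
    by apply: perm_missing; rewrite perm_catC -ep.
  have sq : size q = m + size w1.
    by move: szp szw; rewrite ep size_cat /=; clear; lia.
  right; exists (fl q); split.
  - by rewrite -sq perm_fl // (perm_uniq pq) filter_uniq ?iota_uniq.
  - by apply/peel_fl_v/peel_fl_p.
  rewrite bslash_relabel (_ : size (fl q) = size q) ?size_map // sq.
  rewrite (_ : m + size w1 + size (m.+1 :: w2) = (m + n).+1) ?relabel_fl ?missing_sorted //=.
  by move: szw; clear; lia.
case=> -[q [pq /[dup] P]].
  have sq : size q = size u2 + n by rewrite (perm_size pq) size_iota.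
  have uq : uniq q by rewrite (perm_uniq pq) iota_uniq.
  move=> /peel_fl_u Q; rewrite slash_relabel size_rcons sq.
  rewrite (_ : (size u1).+1 + (size u2 + n) = (m + n).+1); last by move: szu; clear; lia.
  have sc := missing_sorted (m + n).+1 (rcons u1 m.+1).
  have szc : size (missing (m + n).+1 (rcons u1 m.+1)) = size q.
    by rewrite size_missing // size_rcons sq; move: szu; clear; lia.
  move=> ->; have pp : perm_eq (rcons u1 m.+1 ++ relabel (missing (m + n).+1 (rcons u1 m.+1)) q)
      (iota 1 (m + n).+1).
    by apply: perm_trans (perm_cat_missing ua suba); rewrite perm_cat2l perm_relabel.
  split=> //; rewrite -cat_rcons; apply: peel_prefix => //.
    by rewrite cat_rcons; apply: low.
  exact: peel_relabel.
have sq : size q = m + size w1 by rewrite (perm_size pq) size_iota.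
have uq : uniq q by rewrite (perm_uniq pq) iota_uniq.
move=> /peel_fl_v Q; rewrite bslash_relabel sq.
rewrite (_ : m + size w1 + size (m.+1 :: w2) = (m + n).+1); last by move: szw; clear => /=; lia.
have sc := missing_sorted (m + n).+1 (m.+1 :: w2).
have szc : size (missing (m + n).+1 (m.+1 :: w2)) = size q.
  by rewrite size_missing // sq /=; move: szw; clear; lia.
set q' := relabel _ q => ->.
have pp : perm_eq (q' ++ m.+1 :: w2) (iota 1 (m + n).+1).
  rewrite perm_catC; apply: perm_trans (perm_cat_missing ub subb).
  by rewrite perm_cat2l perm_relabel.
split=> //.
(* The fixed letters form a suffix here, so [peel_prefix] is applied to the reversed words. *)
rewrite -[q' ++ _]revK -[w1 ++ _]revK -[u1 ++ _]revK.
apply: (@peel_rev (fun x y => ltn y x)); rewrite [rev (q' ++ _)]rev_cat [rev (w1 ++ _)]rev_cat.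
apply: peel_prefix; first exact: strict_order_flip.
  by rewrite -!rev_cat; apply/lower_part_rev/low'.
by apply/peel_rev/peel_relabel.
Qed.


(** Induction on the fuel, which suffices because each recursive call shortens [u] or [v]. The three
    branches are the three preceding equivalences. *)
Lemma mem_Ssh_rec (f m n : nat) (u v p : seq nat) :
  perm_eq u (iota 1 m.+1) -> perm_eq v (iota 1 n.+1) -> m.+1 + n.+1 <= f ->
  p \in Ssh_rec f u v <-> perm_eq p (iota 1 (m + n).+1) /\ peel ltn u v p.
Proof.
elim: f => [|f IH] in m n u v p *; first by lia.
move=> pu pv le_f.
have su : size u = m.+1 by rewrite (perm_size pu) size_iota.
have sv : size v = n.+1 by rewrite (perm_size pv) size_iota.
have pw := perm_wup m pv.
(* [peel] does not see the shift of [v]; after shifting, both words consist of actual letters of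
   [p]. *)
suff H : p \in Ssh_rec f.+1 u v <->
    perm_eq p (iota 1 (m + n).+1) /\ peel ltn u (wup v m) p.
  by apply: (iff_trans H); split=> -[? ?]; split=> //; apply/(peel_wup m).
rewrite /= su /=.
have take_u : take m.+1 u = u by rewrite take_oversize // su.
case: eqP => [eu|neu].
  rewrite inE; apply: (iff_trans (iff_sym (rwP eqP))).
  have eu' : u = rcons (take m u) m.+1 by rewrite -[in RHS]eu -take_nth ?su // take_u.
  by rewrite {2}eu'; apply: peel_max_lastP => //; rewrite -eu'.
have szw : size (wup v m) = n.+1 by rewrite size_map.
case: eqP => [ew|new].
  rewrite inE; apply: (iff_trans (iff_sym (rwP eqP))).
  case: (wup v m) szw ew pw => [//|_ w] _ /= -> pw.
  exact: peel_min_headP.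
have Mu : m.+1 \in u by rewrite (perm_mem pu) mem_iota; lia.
have Mw : m.+1 \in wup v m by rewrite (perm_mem pw) mem_iota; lia.
have uu : uniq u by rewrite (perm_uniq pu) iota_uniq.
have uw : uniq (wup v m) by rewrite (perm_uniq pw) iota_uniq.
have indexE s1 s2 : uniq (s1 ++ m.+1 :: s2) -> index m.+1 (s1 ++ m.+1 :: s2) = size s1.
  rewrite cat_uniq /= negb_or => /and3P[_ /andP[s1M _] _].
  by rewrite index_cat (negPf s1M) /= eqxx addn0.
have [w1 [w2 ew]] : exists w1 w2, wup v m = w1 ++ m.+1 :: w2.
  by case/splitPr: Mw => w1 w2; exists w1, w2.
have [u1 [u2 eu]] : exists u1 u2, u = u1 ++ m.+1 :: u2.
  by case/splitPr: Mu => u1 u2; exists u1, u2.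
(* The length [k] is read off the shifted word while the prefix is taken from [v]; flattening hides
   the shift. *)
have -> : fl (take (index m.+1 (wup v m)) v) = fl w1.
  by rewrite -(fl_wup _ m) /wup map_take -/(wup v m) ew indexE -?ew // ew take_size_cat.
rewrite ew in pw new szw uw *; subst u.
have -> : take (index m.+1 (u1 ++ m.+1 :: u2)).+1 (u1 ++ m.+1 :: u2) = rcons u1 m.+1.
  by rewrite indexE // -cat_rcons take_size_cat ?size_rcons.
have -> : drop (index m.+1 (u1 ++ m.+1 :: u2)).+1 (u1 ++ m.+1 :: u2) = u2.
  by rewrite indexE // -cat_rcons drop_size_cat ?size_rcons.
have -> : drop (index m.+1 (w1 ++ m.+1 :: w2)) (w1 ++ m.+1 :: w2) = m.+1 :: w2.
  by rewrite indexE // drop_size_cat.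
rewrite mem_cat.
(* Since cases (a) and (b) are excluded, [m.+1] is neither the last letter of [u] nor the first
   letter of the shifted [v]. *)
have u20 : 0 < size u2.
  case: u2 {Mu uu} => // in su neu pu take_u *; case: neu; move: su; rewrite size_cat /= addn1 => -[<-].
  by rewrite nth_cat ltnn subnn.
have w10 : 0 < size w1 by case: (w1) new.
apply: iff_trans (iff_sym (peel_splitP _ pu pw u20 w10)).
have uu2 : uniq u2 by move: uu; rewrite cat_uniq /= => /and3P[_ _ /andP[]].
have uw1 : uniq w1 by move: uw; rewrite cat_uniq => /and3P[].
have szu : size u1 + size u2 = m by move: su; rewrite size_cat /=; lia.
have szw' : size w1 + size w2 = n by move: szw; rewrite size_cat /=; lia.
have IHu q : q \in Ssh_rec f (fl u2) v <->
    perm_eq q (iota 1 (size u2 + n)) /\ peel ltn (fl u2) (w1 ++ m.+1 :: w2) q.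
  (* A permutation of [size u2] letters belongs to the symmetric group indexed by
     [((size u2).-1).+1], hence the predecessor in the role of [m]. *)
  have -> : size u2 + n = ((size u2).-1 + n).+1 by move: u20; clear; lia.
  rewrite -ew; apply: (@iff_trans _ (perm_eq q (iota 1 ((size u2).-1 + n).+1) /\
    peel ltn (fl u2) v q)); last by split=> -[? ?]; split=> //; apply/(peel_wup m).
  apply: IH => //; first by rewrite prednK // perm_fl.
  by move: u20 szu le_f; clear; lia.
have IHw q : q \in Ssh_rec f (u1 ++ m.+1 :: u2) (fl w1) <->
    perm_eq q (iota 1 (m + size w1)) /\ peel ltn (u1 ++ m.+1 :: u2) (fl w1) q.
  have -> : m + size w1 = (m + (size w1).-1).+1 by move: w10; clear; lia.
  apply: IH => //; first by rewrite prednK // perm_fl.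
  by move: w10 szw' le_f; clear; lia.
split=> [/orP[]/mapP[q]|].
- by move=> /IHu [? ?] ->; left; exists q.
- by move=> /IHw [? ?] ->; right; exists q.
case=> -[q [pq Pq ->]]; apply/orP; [left | right]; apply/mapP; exists q => //.
  exact/IHu.
exact/IHw.
Qed.

Lemma mem_Ssh (m n : nat) (u v p : seq nat) :
  perm_eq u (iota 1 m.+1) -> perm_eq v (iota 1 n.+1) ->
  p \in Ssh u v <-> perm_eq p (iota 1 (m + n).+1) /\ peel ltn u v p.
Proof.
move=> pu pv; rewrite /Ssh mem_undup; apply: mem_Ssh_rec => //.
by rewrite (perm_size pu) (perm_size pv) !size_iota.
Qed.

(** * Reduced words *)


Lemma ninv_cons (x : nat) (s : seq nat) : ninv (x :: s) = count (ltn^~ x) s + ninv s.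
Proof.
rewrite /ninv /= drop0; congr addn; congr sumn.
by rewrite -[1]addn0 iotaDl -map_comp.
Qed.

Lemma ninv_rcons (z : nat) (s : seq nat) : ninv (rcons s z) = count (ltn z) s + ninv s.
Proof.
elim: s => [//|x s IH].
by rewrite rcons_cons !ninv_cons IH -cats1 count_cat /=; lia.
Qed.

Lemma ninv_swap (a b : nat) (s1 s2 : seq nat) : a < b ->
  ninv (s1 ++ b :: a :: s2) = (ninv (s1 ++ a :: b :: s2)).+1.
Proof.
move=> ab; elim: s1 => [|x s1 IH].
  by rewrite /= !ninv_cons /= ab (_ : b < a = false); lia.
by rewrite !cat_cons !ninv_cons IH !count_cat /=; lia.
Qed.

Lemma ninv_iota (k n : nat) : ninv (iota k n) = 0.
Proof.
elim: n k => [//|n IH] k; rewrite [iota _ _]/= ninv_cons IH addn0.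
by apply/eqP; rewrite -leqn0 leqNgt -has_count; apply/hasPn => x; rewrite mem_iota /=; lia.
Qed.

Lemma ninv0_iota (k n : nat) (s : seq nat) :
  perm_eq s (iota k n) -> ninv s = 0 -> s = iota k n.
Proof.
elim: n k s => [|n IH] k [|x s]; do ?by move/perm_size.
move=> pe; rewrite ninv_cons => e.
have xk : x = k.
  have : k \in x :: s by rewrite (perm_mem pe) mem_iota; lia.
  rewrite inE => /predU1P[//|ks].
  have : x \in iota k n.+1 by rewrite -(perm_mem pe) mem_head.
  rewrite mem_iota leq_eqVlt => /andP[/predU1P[//|kx] _].
  have : has (ltn^~ x) s by apply/hasP; exists k.
  by rewrite has_count; lia.
rewrite xk in pe *; rewrite [RHS]/= -(IH k.+1 s) //; last by lia.
by move: pe; rewrite /= perm_cons.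
Qed.

(** By the rank condition, deleting an end letter removes as many inversions from [p] as from [u] or
    [v]. So Coxeter lengths add up. *)
Lemma peel_ninv (u v p : seq nat) : peel ltn u v p -> ninv p = ninv u + ninv v.
Proof.
elim=> [//|x y u' v' p' e _ IH|y z u' v' p' e _ IH].
  by rewrite !ninv_cons IH e addnA.
by rewrite !ninv_rcons IH e addnCA.
Qed.

Lemma peel_iota (m n : nat) :
  peel ltn (iota 1 m.+1) (iota 1 n.+1) (iota 1 (m + n).+1).
Proof.
have eu : iota 1 m.+1 = rcons (iota 1 m) m.+1.
  by rewrite -{1}(addn1 m) iotaD cats1 add1n.
have ew : wup (iota 1 n.+1) m = iota m.+1 n.+1.
  rewrite -(addn1 m) iotaDl; apply: eq_map => i; exact: addnC.
apply/(peel_wup m); rewrite ew eu.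
have [|//|/(_ erefl) []] := @peel_max_lastP m n (iota 1 m) (iota m.+1 n.+1)
   (iota 1 m ++ iota m.+1 n.+1); first by rewrite -eu.
by rewrite -addnS iotaD add1n.
Qed.

Lemma split_adjacent (s : seq nat) (i : nat) : 0 < i < size s ->
  exists s1 a b s2, s = s1 ++ a :: b :: s2 /\ i = (size s1).+1.
Proof.
case: i => // i /= lt; exists (take i s), (nth 0 s i), (nth 0 s i.+1), (drop i.+2 s).
rewrite size_takel 1?ltnW 1?ltnW //; split=> //.
by rewrite -!drop_nth ?cat_take_drop // ltnW.
Qed.

Lemma sswap_adjacent (a b : nat) (s1 s2 : seq nat) :
  sswap (size s1).+1 (s1 ++ a :: b :: s2) = s1 ++ b :: a :: s2.
Proof.
apply: (@eq_from_nth _ 0); first by rewrite size_map size_iota !size_cat.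
move=> k; rewrite size_map size_iota => lt.
rewrite (nth_map 0) ?size_iota // nth_iota // add0n /=.
case: (eqVneq k (size s1)) => [->|neq1].
  by rewrite !nth_cat ltnn subnn ltnNge leqnSn /= subSn // subnn.
case: (eqVneq k (size s1).+1) => [->|neq2].
  by rewrite !nth_cat ltnn subnn ltnNge leqnSn /= subSn // subnn.
rewrite !nth_cat; case: ltnP => // le.
by have -> : k - size s1 = (k - size s1 - 2).+2 by lia.
Qed.

Lemma perm_swap_adjacent (a b : nat) (s1 s2 : seq nat) :
  perm_eq (s1 ++ b :: a :: s2) (s1 ++ a :: b :: s2).
Proof. by rewrite perm_cat2l; apply/permPl/(perm_catCA [:: b] [:: a]). Qed.

Lemma perm_of_word_rcons (N i : nat) (w : seq nat) :
  perm_of_word N (rcons w i) = sswap i (perm_of_word N w).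
Proof. by rewrite /perm_of_word foldl_rcons. Qed.

Definition is_letter (N : nat) : pred nat := fun i => 0 < i < N.

Lemma perm_perm_of_word (N : nat) (w : seq nat) :
  all (is_letter N) w -> perm_eq (perm_of_word N w) (iota 1 N).
Proof.
elim/last_ind: w => [//|w i IH]; rewrite all_rcons => /andP[li /IH pw].
have sz : size (perm_of_word N w) = N by rewrite (perm_size pw) size_iota.
rewrite perm_of_word_rcons.
have [|s1 [a [b [s2 [es ->]]]]] := @split_adjacent (perm_of_word N w) i; first by rewrite sz.
rewrite es in pw *; rewrite sswap_adjacent; apply: perm_trans pw.
exact: perm_swap_adjacent.
Qed.

Lemma ninv_perm_of_word (N : nat) (w : seq nat) :
  all (is_letter N) w -> ninv (perm_of_word N w) <= size w.
Proof.
elim/last_ind: w => [|w i IH]; first by rewrite /= ninv_iota.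
rewrite all_rcons => /andP[li lw]; have le := IH lw.
have sz : size (perm_of_word N w) = N.
  by rewrite (perm_size (perm_perm_of_word lw)) size_iota.
rewrite perm_of_word_rcons size_rcons.
have [|s1 [a [b [s2 [es ->]]]]] := @split_adjacent (perm_of_word N w) i; first by rewrite sz.
move: le; rewrite es sswap_adjacent; case: (ltngtP a b) => [ab|ba|->].
- by rewrite (ninv_swap _ _ ab) ltnS.
- by rewrite (ninv_swap _ _ ba); lia.
- by move/leqW.
Qed.

Lemma mem_words (n L : nat) (w : seq nat) :
  (w \in words n L) = (size w == L) && all (is_letter n.+1) w.
Proof.
elim: L w => [|L IH] [|i w] //=.
  by apply/negbTE/allpairsPdep => -[? [? [_ _]]].
rewrite eqSS; apply/allpairsPdep/and3P => [[j [t [jn tw [-> ->]]]]|[sz li lw]].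
  by move: tw jn; rewrite IH mem_iota => /andP[-> ->]; split.
by exists i, w; rewrite IH sz lw mem_iota; split.
Qed.

Lemma uniq_words (n L : nat) : uniq (words n L).
Proof.
elim: L => [//|L IH] /=; apply: allpairs_uniq; rewrite ?iota_uniq //.
by move=> [i s] [j t] _ _ [-> ->].
Qed.

Lemma mem_redwords (N : nat) (p w : seq nat) : perm_eq p (iota 1 N.+1) ->
  w \in redwords p <->
  [/\ all (is_letter N.+1) w, size w = ninv p & perm_of_word N.+1 w = p].
Proof.
move=> pp; have sz : size p = N.+1 by rewrite (perm_size pp) size_iota.
rewrite /redwords mem_filter sz mem_words.
by split=> [/and3P[/eqP ? /eqP ? ?]|[-> -> ->]] //; rewrite !eqxx.
Qed.

Lemma redwords_nil (N : nat) (p : seq nat) : perm_eq p (iota 1 N.+1) ->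
  [::] \in redwords p <-> p = iota 1 N.+1.
Proof.
move=> pp; apply: (iff_trans (mem_redwords _ pp)).
by split=> [[_ _ <-]|->]; rewrite ?ninv_iota.
Qed.

(** The last letter of a reduced word marks a descent of its product: at an ascent, the product of
    [w] would have more inversions than [w] has letters. *)
Lemma redwords_rcons (N a b : nat) (s1 s2 w : seq nat) :
  perm_eq (s1 ++ a :: b :: s2) (iota 1 N.+1) ->
  rcons w (size s1).+1 \in redwords (s1 ++ a :: b :: s2) <->
  b < a /\ w \in redwords (s1 ++ b :: a :: s2).
Proof.
move=> pp; have pp' := perm_trans (perm_swap_adjacent a b s1 s2) pp.
have li : is_letter N.+1 (size s1).+1.
  by have := perm_size pp; rewrite size_cat size_iota /is_letter /= => ?; lia.
split=> [/(mem_redwords _ pp)|[ba /(mem_redwords _ pp') [lw sw ew]]]; last first.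
  apply/(mem_redwords _ pp); split; first by rewrite all_rcons li.
    by rewrite size_rcons sw (ninv_swap _ _ ba).
  by rewrite perm_of_word_rcons ew sswap_adjacent.
rewrite all_rcons size_rcons perm_of_word_rcons => -[/andP[_ lw] sw ew].
have sz : size (perm_of_word N.+1 w) = N.+1.
  by rewrite (perm_size (perm_perm_of_word lw)) size_iota.
have [t1 [c [d [t2 [es /eqP e]]]]] := @split_adjacent (perm_of_word N.+1 w) (size s1).+1
  (etrans (congr1 (fun k => 0 < (size s1).+1 < k) sz) li).
have {}e : size s1 = size t1 by move: e => /eqP [].
move: ew; rewrite es e sswap_adjacent => /eqP.
rewrite eqseq_cat // => /andP[/eqP ? /eqP [? ? ?]]; subst t1 d c t2.
have le := ninv_perm_of_word lw; rewrite es in le.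
case: (ltngtP a b) => [ab|ba|ab]; first by move: sw le; rewrite (ninv_swap _ _ ab); lia.
  by split=> //; apply/(mem_redwords _ pp'); split=> //; move: sw; rewrite (ninv_swap _ _ ba) => -[].
have := iota_uniq 1 N.+1; rewrite -(perm_uniq pp) cat_uniq ab /= inE eqxx /=.
by rewrite !andbF.
Qed.

(** Reversing the words and flipping the order exchanges the roles of [u] and [v]. The place of the
    pair is now counted from the right end, hence [size v2 = size p2]. *)
Lemma peel_adjacent_right (r : rel nat) (a b x y : nat) (u v1 v2 p1 p2 : seq nat) :
  strict_order r -> size v2 = size p2 -> uniq (p1 ++ x :: y :: p2) ->
  peel r u (v1 ++ a :: b :: v2) (p1 ++ x :: y :: p2) ->
  (r a b -> r x y /\ peel r u (v1 ++ b :: a :: v2) (p1 ++ y :: x :: p2)) /\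
  (r b a -> r y x -> peel r u (v1 ++ b :: a :: v2) (p1 ++ y :: x :: p2)).
Proof.
have revE c d (s1 s2 : seq nat) : rev (s1 ++ c :: d :: s2) = rev s2 ++ d :: c :: rev s1.
  by rewrite rev_cat !rev_cons !cat_rcons.
move=> so sz un /peel_rev; rewrite !revE => P.
have sz' : size (rev v2) = size (rev p2) by rewrite !size_rev.
have un' : uniq (rev p2 ++ y :: x :: rev p1) by rewrite -revE rev_uniq.
have [H1 H2] := peel_adjacent (strict_order_flip so) sz' un' P.
by split=> [/H1 [xy /peel_rev]|/H2 Q /Q /peel_rev]; rewrite !revE !revK.
Qed.

(** Removing the last letter swaps two neighbours in the product and in exactly one of [u] and [v].
    The adjacency lemmas match a descent of that word with a descent of the product, so reducedness
    passes in both directions. *)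
Lemma redwords_shuffle (m n : nat) (w u v : seq nat) : all (is_letter (m + n).+1) w ->
  perm_eq u (iota 1 m.+1) -> perm_eq v (iota 1 n.+1) ->
  [seq i <- w | i <= m] \in redwords u /\
    [seq i - m | i <- w & m < i] \in redwords v <->
  w \in redwords (perm_of_word (m + n).+1 w) /\
    peel ltn u v (perm_of_word (m + n).+1 w).
Proof.
elim/last_ind: w u v => [|w i IH] u v.
  move=> _ pu pv /=.
  have nil_red k : [::] \in redwords (iota 1 k.+1) by apply/redwords_nil.
  split=> [[/(redwords_nil pu) -> /(redwords_nil pv) ->]|[_ /peel_ninv]].
    by split; [apply: nil_red | apply: peel_iota].
  (* The identity has no inversions, so by additivity [u] and [v] have none and are identities as
     well. *)
  rewrite (ninv_iota 1 (m + n).+1) => /esym/eqP; rewrite addn_eq0 => /andP[/eqP eu /eqP ev].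
  by rewrite (ninv0_iota pu eu) (ninv0_iota pv ev).
rewrite all_rcons => /andP[li lw] pu pv.
have pp := perm_perm_of_word lw; have {}IH := fun u v => IH u v lw.
have sz : size (perm_of_word (m + n).+1 w) = (m + n).+1 by rewrite (perm_size pp) size_iota.
have un : uniq (perm_of_word (m + n).+1 w) by rewrite (perm_uniq pp) iota_uniq.
rewrite perm_of_word_rcons.
have [|p1 [x [y [p2 [ep ei]]]]] := @split_adjacent (perm_of_word (m + n).+1 w) i.
  by rewrite sz.
have -> : sswap i (perm_of_word (m + n).+1 w) = p1 ++ y :: x :: p2.
  by rewrite ep ei sswap_adjacent.
rewrite ep in IH pp sz un.
have pp' := perm_trans (perm_swap_adjacent x y p1 p2) pp.
have un' : uniq (p1 ++ y :: x :: p2) by rewrite (perm_uniq pp') iota_uniq.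
have Rp : rcons w i \in redwords (p1 ++ y :: x :: p2) <->
    x < y /\ w \in redwords (p1 ++ x :: y :: p2).
  by rewrite ei; apply: redwords_rcons pp'.
rewrite !filter_rcons; case: (leqP i m) => [le_m|gt_m] /=.
  have [|u1 [a [b [u2 [eu ei']]]]] := @split_adjacent u i.
    by rewrite (perm_size pu) size_iota; move: li; rewrite /is_letter; lia.
  have szu : size u1 = size p1 by move: ei ei' => -> [].
  subst u; have pu' := perm_trans (perm_swap_adjacent a b u1 u2) pu.
  split.
    rewrite {1}ei' => -[/(redwords_rcons _ pu) [ba Fu] Fv].
    have [|Pw Q] := (IH _ v pu' pv).1; first by split.
    have [/(_ ba) [xy Q'] _] := peel_adjacent strict_order_ltn szu un Q.
    by split=> //; apply/Rp.
  case=> /Rp [xy Pw] Q.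
  have [H1 H2] := peel_adjacent strict_order_ltn szu un' Q.
  have ba : b < a.
    case: (ltngtP b a) => // [/H1 [/= yx _]|ab]; first by move: xy yx; lia.
    have := iota_uniq 1 m.+1; rewrite -(perm_uniq pu) cat_uniq ab /= inE eqxx /=.
    by rewrite !andbF.
  have [|Fu Fv] := (IH _ v pu' pv).2; first by split=> //; apply: H2.
  by rewrite {1}ei'; split=> //; apply/(redwords_rcons _ pu).
have [|v1 [a [b [v2 [ev ei']]]]] := @split_adjacent v (i - m).
  by rewrite (perm_size pv) size_iota; move: li; rewrite /is_letter; lia.
subst v.
(* Place [i - m] in [v] and place [i] in the product are equally far from the right end, as the
   lengths [n.+1] and [(m + n).+1] also differ by [m]. *)
have szv : size v2 = size p2.
  have szv : size (v1 ++ a :: b :: v2) = n.+1 by rewrite (perm_size pv) size_iota.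
  by move: szv sz ei ei' gt_m; rewrite !size_cat /=; clear; lia.
have pv' := perm_trans (perm_swap_adjacent a b v1 v2) pv.
rewrite map_rcons ei'; split.
  case=> Fu /(redwords_rcons _ pv) [ba Fv].
  have [|Pw Q] := (IH u _ pu pv').1; first by split.
  have [/(_ ba) [xy Q'] _] := peel_adjacent_right strict_order_ltn szv un Q.
  by split=> //; apply/Rp.
case=> /Rp [xy Pw] Q.
have [H1 H2] := peel_adjacent_right strict_order_ltn szv un' Q.
have ba : b < a.
  case: (ltngtP b a) => // [/H1 [/= yx _]|ab]; first by move: xy yx; lia.
  have := iota_uniq 1 n.+1; rewrite -(perm_uniq pv) cat_uniq ab /= inE eqxx /=.
  by rewrite !andbF.
have [|Fu Fv] := (IH u _ pu pv').2; first by split=> //; apply: H2.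
by split=> //; apply/(redwords_rcons _ pv).
Qed.

(** * Shuffles *)


Lemma shuffle_nil (a : seq nat) : shuffle a [::] = [:: a].
Proof. by case: a. Qed.

Lemma shuffle_cons (x y : nat) (a b : seq nat) : shuffle (x :: a) (y :: b) =
  [seq x :: s | s <- shuffle a (y :: b)] ++ [seq y :: s | s <- shuffle (x :: a) b].
Proof. by []. Qed.

(** The predicate [P] separates the alphabets of [a] and [b], so a word determines which of its
    letters come from which factor. *)
Lemma mem_shuffle (P : pred nat) (a b c : seq nat) :
  all P a -> all (predC P) b ->
  c \in shuffle a b <-> filter P c = a /\ filter (predC P) c = b.
Proof.
have cons_mem (x : nat) z s (L : seq (seq nat)) : (z :: s \in [seq x :: t | t <- L]) = (z == x) && (s \in L).
  case: eqP => [->|ne]; first by rewrite mem_map // => ? ? [].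
  by apply/negbTE/mapP => -[t _ [/ne]].
have nil_mem (x : nat) (L : seq (seq nat)) : ([::] \in [seq x :: t | t <- L]) = false.
  by apply/negbTE/mapP => -[t].
have filter_full (Q : pred nat) s : filter (predC Q) s = [::] -> filter Q s = s.
  by move/eqP; rewrite -(negbK (_ == _)) -has_filter has_predC negbK => /all_filterP.
have [k] := ubnP (size c); elim: k => // k IH in a b c *; rewrite ltnS => le_k Pa Pb.
case: a Pa => [|x a] Pa.
  rewrite inE; split=> [/eqP ->|[e1 e2]].
    split; last exact/all_filterP.
    by apply/eqP; rewrite -(negbK (_ == _)) -has_filter -all_predC.
  by rewrite -e2 (filter_full (predC P)) // -e1; apply: eq_filter => z /=; rewrite negbK.
case: b Pb => [|y b] Pb.
  rewrite shuffle_nil inE; split=> [/eqP ->|[e1 e2]].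
    split; first exact/all_filterP.
    apply/eqP; rewrite -(negbK (_ == _)) -has_filter -all_predC.
    by apply: sub_all Pa => z /=; rewrite negbK.
  by rewrite -e1 filter_full.
rewrite shuffle_cons mem_cat; case: c le_k => [|z c] le_k.
  by rewrite !nil_mem; split=> // -[].
rewrite !cons_mem /=; case/andP: (Pa) => Px Pa'; case/andP: (Pb) => /= Py Pb'.
case: eqP => [zx|nzx] /=.
  rewrite zx Px /= (_ : x == y = false) ?orbF; last by apply/eqP => xy; rewrite -xy Px in Py.
  apply: (iff_trans (IH a (y :: b) c le_k Pa' Pb)).
  by split=> [[-> ->]|[[->] ->]].
case: eqP => [zy|nzy] /=.
  rewrite zy (negPf Py) /=; apply: (iff_trans (IH (x :: a) b c le_k Pa Pb')).
  by split=> [[-> ->]|[-> [->]]].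
by split=> //; case: (P z) => /= -[] => [[/nzx]|_ [/nzy]].
Qed.

(** With separated alphabets, the two halves of the recursion begin with different letters and are
    disjoint. *)
Lemma uniq_shuffle (P : pred nat) (a b : seq nat) :
  all P a -> all (predC P) b -> uniq (shuffle a b).
Proof.
elim: a b => [//|x a IHa] b Pa; elim: b => [//|y b IHb] Pb.
rewrite shuffle_cons cat_uniq !map_inj_uniq; do ?by move=> ? ? [].
case/andP: (Pa) => Px Pa'; case/andP: (Pb) => /= Py Pb'.
rewrite IHa // IHb // andbT /=; apply/hasPn => _ /mapP[s _ ->].
by apply/mapP => -[t _ [yx _]]; rewrite yx Px in Py.
Qed.

(** The key [g] recovers from an entry the block it came from, so different blocks are disjoint. *)
Lemma uniq_flatten_key (S T : eqType) (f : S -> seq T) (g : T -> S) (s : seq S) :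
  uniq s -> {in s, forall x, uniq (f x)} ->
  {in s, forall x, {in f x, forall y, g y = x}} -> uniq (flatten [seq f x | x <- s]).
Proof.
elim: s => [//|x s IH] /= /andP[xs us] uf gf.
have sub z : z \in s -> z \in x :: s by rewrite inE orbC => ->.
rewrite cat_uniq uf ?mem_head // IH //; last first.
- by move=> z /sub /gf.
- by move=> z /sub /uf.
rewrite andbT /=; apply/hasPn => y /flatten_mapP[z zs yz]; apply/negP => yx.
by move: xs; rewrite -(gf x (mem_head _ _) y yx) (gf z (sub z zs) y yz) zs.
Qed.

(** * The two sides of the theorem as lists of words *)

Lemma mem_shuffle_redwords (m n : nat) (a b c : seq nat) :
  all (is_letter m.+1) a -> all (is_letter n.+1) b ->
  c \in shuffle a (wup b m) <->
  [/\ all (is_letter (m + n).+1) c, [seq i <- c | i <= m] = a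
    & [seq i - m | i <- c & m < i] = b].
Proof.
move=> la lb.
have Pa : all (fun i => i <= m) a by apply: sub_all la => i /andP[].
have Pb : all (predC (fun i => i <= m)) (wup b m).
  by rewrite all_map; apply: sub_all lb => i /=; rewrite /is_letter; lia.
have predCE : predC (fun i => i <= m) =1 ltn m by move=> i /=; rewrite ltnNge.
apply: (iff_trans (mem_shuffle _ Pa Pb)); rewrite (eq_filter predCE).
split=> [[ea eb]|[lc ea eb]]; last first.
  split=> //; rewrite -eb /wup -map_comp map_id_in // => i.
  by rewrite mem_filter /= => /andP[lt _]; rewrite subnK // ltnW.
split=> //; last first.
  by rewrite eb /wup -map_comp map_id_in // => i _ /=; rewrite addnK.
apply/allP => i ic; case: (leqP i m) => im.
  have : i \in a by rewrite -ea mem_filter im.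
  by move/(allP la); rewrite /is_letter; lia.
have : i \in wup b m by rewrite -eb mem_filter /= im.
by case/mapP => j /(allP lb) + ->; rewrite /is_letter; lia.
Qed.

Lemma redwords_letters (N : nat) (p w : seq nat) : perm_eq p (iota 1 N.+1) ->
  w \in redwords p -> all (is_letter N.+1) w.
Proof. by move=> pp /(mem_redwords _ pp) []. Qed.

Lemma perm_shuffle_redwords (m n : nat) (u v : seq nat) :
  perm_eq u (iota 1 m.+1) -> perm_eq v (iota 1 n.+1) ->
  perm_eq
    (flatten [seq shuffle ab.1 (wup ab.2 m)
             | ab <- [seq (a, b) | a <- redwords u, b <- redwords v]])
    (flatten [seq redwords p | p <- Ssh u v]).
Proof.
move=> pu pv; have uR p : uniq (redwords p) by rewrite filter_uniq ?uniq_words.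
have letters a b : (a, b) \in [seq (a, b) | a <- redwords u, b <- redwords v] ->
    all (is_letter m.+1) a /\ all (is_letter n.+1) b.
  move/allpairsP => [[a' b'] [/= Ra Rb [-> ->]]].
  by split; [apply: redwords_letters pu Ra | apply: redwords_letters pv Rb].
apply: uniq_perm.
(* The key is the pair of restrictions to the letters at most [m] and above [m], the latter shifted
   back. *)
- apply: (@uniq_flatten_key _ _ _
    (fun c => ([seq i <- c | i <= m], [seq i - m | i <- c & m < i]))).
  + by apply: allpairs_uniq => // -[? ?] [? ?] _ _ [-> ->].
  + move=> [a b] /letters [/= la lb].
    apply: (@uniq_shuffle (fun i => i <= m)); first by apply: sub_all la => i /andP[].
    by rewrite all_map; apply: sub_all lb => i /=; rewrite /is_letter; lia.
  + by move=> [a b] /letters [la lb] c /(mem_shuffle_redwords _ la lb) [_ -> ->].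
(* Here the key is the product, since a word is a reduced word of its own product only. *)
- apply: (@uniq_flatten_key _ _ _ (perm_of_word (m + n).+1)) => //.
    by rewrite /Ssh undup_uniq.
  by move=> p /(mem_Ssh _ pu pv) [pp _] w /(mem_redwords _ pp) [].
move=> c; apply/flatten_mapP/flatten_mapP => [[[a b]]|[p /(mem_Ssh _ pu pv) [pp P] Rc]].
  move=> Rab; have [la lb] := letters _ _ Rab.
  move=> /(mem_shuffle_redwords _ la lb) [lc ea eb].
  case/allpairsP: Rab => [[a' b'] [/= Ra Rb [? ?]]]; subst a' b'.
  have [|Rc P] := (redwords_shuffle lc pu pv).1; first by rewrite ea eb.
  exists (perm_of_word (m + n).+1 c) => //; apply/(mem_Ssh _ pu pv); split=> //.
  exact: perm_perm_of_word.
have [lc _ ec] := (mem_redwords _ pp).1 Rc.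
have [|Ra Rb] := (redwords_shuffle lc pu pv).2; first by rewrite ec.
exists ([seq i <- c | i <= m], [seq i - m | i <- c & m < i]).
  by apply/allpairsP; exists ([seq i <- c | i <= m], [seq i - m | i <- c & m < i]).
by apply/mem_shuffle_redwords; [exact: redwords_letters pu Ra | exact: redwords_letters pv Rb | split].
Qed.

Local Open Scope ring_scope.

Theorem theorem4p6 (K : fieldType) (m n : nat) (u v : seq nat) :
  perm_eq u (iota 1 m.+1) -> perm_eq v (iota 1 n.+1) ->
  nabla (tens_bracket K u v) = (fun x y => \sum_(p <- Ssh u v) bracket K p x y).
Proof.
move=> pu pv; apply: functional_extensionality => x; apply: functional_extensionality => y.
have su : (size u).-1 = m by rewrite (perm_size pu) size_iota.
have sv : (size v).-1 = n by rewrite (perm_size pv) size_iota.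
(* All coefficients in [tens_bracket] are 1, so each side is a sum of [brk] over a list of words;
   the two lists are permutations of each other. *)
transitivity (\sum_(c <- flatten [seq redwords p | p <- Ssh u v]) brk K (c, (m + n)%N) x y).
  rewrite -(perm_big _ (perm_shuffle_redwords pu pv)) big_flatten big_map.
  rewrite big_allpairs_dep /nabla /tens_bracket big_allpairs_dep.
  apply: eq_bigr => a _; apply: eq_bigr => b _.
  by rewrite GRing.mul1r /opsum big_map su sv.
rewrite big_flatten big_map big_seq [RHS]big_seq; apply: eq_bigr => p.
move=> /(mem_Ssh _ pu pv) [pp _]; rewrite /bracket /opsum big_map.
by rewrite (perm_size pp) size_iota.
Qed.
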